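(* Let $(A,\|\cdot\|)$ be a faithful normed algebra, let $a\in A$, and let $\lambda\in\mathbb{C}$. Then: (1) $\overline{co}\,V_A(a)=V_{A_e^{op}}(a;1)$; (2) $V_{A^{op}}(a)\subseteq\overline{co}\,V_A(a)$; (3) $\overline{co}(V_A(a)\cup\{0\})\subseteq V_{A_e^1}(a;1)$; (4) $V_{A^{op}}(a)\subseteq V_{A_e^{op}}(a;1)$; (5) $V_{A^{op}}(a)\subseteq V_{A_e^1}(a;1)$; (6) $V_{A_e^{op}}(a+\lambda 1;1)\subseteq V_{A_e^1}(a+\lambda 1;1)$.
   Context: A normed algebra $(A,\|\cdot\|)$ is a complex associative algebra with a submultiplicative norm; it is not assumed to be complete or unital. $A$ is faithful if $a=0$ whenever $a\in A$ and $aA=\{0\}$. $A_e=A+\mathbb{C}1$ is the unitization of $A$, where $1$ is the identity of $A_e$. For faithful $A$, the norm $\|\cdot\|$ on $A$ is taken to induce two norms on $A_e$: the operator norm $\|a+\lambda 1\|_{op}=\sup\{\|ax+\lambda x\|:x\in A,\ \|x\|\le 1\}$ and the $\ell^1$-norm $\|a+\lambda 1\|_1=\|a\|+|\lambda|$. Put $A^{op}=(A,\|\cdot\|_{op})$ (the restriction of $\|\cdot\|_{op}$ to $A$), $A_e^{op}=(A_e,\|\cdot\|_{op})$ and $A_e^1=(A_e,\|\cdot\|_1)$. For any normed algebra $B$: $S(B)=\{x\in B:\|x\|=1\}$; $B^*$ is its Banach space dual; $D_B(x)=\{\varphi\in B^*:\|\varphi\|=1=\varphi(x)\}$ for $x\in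 S(B)$; $V_B(b;x)=\{\varphi(bx):\varphi\in D_B(x)\}$ for $b\in B$, $x\in S(B)$; and the spatial numerical range of $b$ is $V_B(b)=\bigcup\{V_B(b;x):x\in S(B)\}$. For $K\subset\mathbb{C}$, $\overline{co}(K)$ is the closed convex hull of $K$. *)

(* Defs.v *)
From HB Require Import structures.
From mathcomp Require Import all_boot all_order all_algebra complex.
From mathcomp Require Import all_classical all_reals all_analysis.

Set Implicit Arguments.
Unset Strict Implicit.
Unset Printing Implicit Defensive.

Import Order.TTheory GRing.Theory Num.Theory.
Import numFieldNormedType.Exports.
Local Open Scope classical_set_scope.
Local Open Scope ring_scope.

Declare Scope nualg_scope.
Delimit Scope nualg_scope with NU.
Reserved Notation "x ** y" (at level 40, left associativity).

(* The scalars are C = R[i]; [Normc.normc : R[i] -> R] is the modulus. *)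
Notation normc := Normc.normc.

(* The algebras of MathComp have a unit, so associative algebras without unit
   are introduced here. *)
HB.mixin Record Lmodule_isNuAlgebra (K : pzRingType) A of GRing.Lmodule K A := {
  numul : A -> A -> A;
  numulA : associative numul;
  numulDl : left_distributive numul +%R;
  numulDr : right_distributive numul +%R;
  numulZl : forall (k : K) x y, numul (k *: x) y = k *: numul x y;
  numulZr : forall (k : K) x y, numul x (k *: y) = k *: numul x y
}.

#[short(type="nuAlgType")]
HB.structure Definition NuAlgebra (K : pzRingType) :=
  { A of GRing.Lmodule K A & Lmodule_isNuAlgebra K A }.

Notation "x ** y" := (numul x y) : nualg_scope.
Local Open Scope nualg_scope.

(* Norms take values in R. The norm of MathComp-Analysis' [normedModType R[i]]
   takes values in R[i] and is always definite, whereas the operator norm on the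
   unitization of A is only a seminorm when A is zero or has an identity: hence
   the seminormed layer. *)
HB.mixin Record NuAlgebra_isSemiNormed (R : realType) A of NuAlgebra R[i] A := {
  anorm : A -> R;
  anormD : forall x y, anorm (x + y) <= anorm x + anorm y;
  anormZ : forall (z : R[i]) x, anorm (z *: x) = normc z * anorm x;
  anormM : forall x y, anorm (x ** y) <= anorm x * anorm y
}.

#[short(type="semiNormedAlgType")]
HB.structure Definition SemiNormedAlgebra (R : realType) :=
  { A of NuAlgebra R[i] A & NuAlgebra_isSemiNormed R A }.

HB.mixin Record SemiNormedAlgebra_isDefinite (R : realType) A
    of SemiNormedAlgebra R A := {
  anorm0_eq0 : forall x : A, anorm x = 0 -> x = 0
}.

#[short(type="normedAlgType")]
HB.structure Definition NormedAlgebra (R : realType) :=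
  { A of SemiNormedAlgebra R A & SemiNormedAlgebra_isDefinite R A }.

Section NuAlgebraTheory.
Variables (K : pzRingType) (A : nuAlgType K).

Lemma numul0r (x : A) : 0 ** x = 0.
Proof. by have := numulZl 0 0 x; rewrite !scale0r. Qed.

Lemma numulr0 (x : A) : x ** 0 = 0.
Proof. by have := numulZr 0 x 0; rewrite !scale0r. Qed.

End NuAlgebraTheory.

Definition faithful (K : pzRingType) (A : nuAlgType K) :=
  forall a : A, (forall x : A, a ** x = 0) -> a = 0.

(* A_e = A + C1, where (a, k) stands for a + k1: the identity 1 is always
   adjoined, also when A has one. *)
Definition unitization (R : realType) (A : nuAlgType R[i]) : Type :=
  (A * R[i]^o)%type.

Section Unitization.
Variables (R : realType) (A : nuAlgType R[i]).
Local Notation Ae := (unitization A).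

HB.instance Definition _ := GRing.Lmodule.copy Ae (A * R[i]^o)%type.

Definition ue_mul (u v : Ae) : Ae :=
  (u.1 ** v.1 + (u.2 : R[i]) *: v.1 + (v.2 : R[i]) *: u.1, u.2 * v.2).

Fact ue_mulA : associative ue_mul.
Proof.
move=> [a k] [b l] [c m]; congr (_, _) => /=; last by rewrite mulrA.
rewrite !numulDl !numulDr !scalerDr !numulZl !numulZr !numulA !scalerA.
rewrite [m * k]mulrC [m * l]mulrC.
by rewrite !addrA [LHS](ACl (1*4*2*5*3*6*7)).
Qed.

Fact ue_mulDl : left_distributive ue_mul +%R.
Proof.
move=> [a k] [b l] [c m]; congr (_, _) => /=; last by rewrite mulrDl.
rewrite numulDl scalerDl scalerDr.
by rewrite !addrA [LHS](ACl (1*3*5*2*4*6)).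
Qed.

Fact ue_mulDr : right_distributive ue_mul +%R.
Proof.
move=> [a k] [b l] [c m]; congr (_, _) => /=; last by rewrite mulrDr.
rewrite numulDr scalerDl scalerDr.
by rewrite !addrA [LHS](ACl (1*3*5*2*4*6)).
Qed.

Fact ue_mulZl (z : R[i]) (u v : Ae) : ue_mul (z *: u) v = z *: ue_mul u v.
Proof.
case: u v => [a k] [b l]; congr (_, _) => /=; last by rewrite -scalerAl.
by rewrite numulZl !scalerDr !scalerA [l * z]mulrC.
Qed.

Fact ue_mulZr (z : R[i]) (u v : Ae) : ue_mul u (z *: v) = z *: ue_mul u v.
Proof.
case: u v => [a k] [b l]; congr (_, _) => /=; last by rewrite -scalerAr.
by rewrite numulZr !scalerDr !scalerA [k * z]mulrC.
Qed.

HB.instance Definition _ := Lmodule_isNuAlgebra.Build R[i] Ae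
  ue_mulA ue_mulDl ue_mulDr ue_mulZl ue_mulZr.

Definition ue_inj (a : A) : Ae := (a, 0).
Definition ue_one : Ae := (0, 1).

Lemma ue_mul1 (u : Ae) : ue_one ** u = u.
Proof.
case: u => a k; congr (_, _) => /=; last by rewrite mul1r.
by rewrite numul0r scale1r scaler0 addr0 add0r.
Qed.

Lemma ue_mulr1 (u : Ae) : u ** ue_one = u.
Proof.
case: u => a k; congr (_, _) => /=; last by rewrite mulr1.
by rewrite numulr0 scaler0 !add0r scale1r.
Qed.

Lemma ue_injM (a b : A) : ue_inj (a ** b) = ue_inj a ** ue_inj b.
Proof. by congr (_, _) => /=; rewrite ?mulr0// !scale0r !addr0. Qed.

End Unitization.

Section Norms.
Variable (R : realType).

Section SemiNormTheory.
Variable A : semiNormedAlgType R.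

Lemma anorm0 : anorm (0 : A) = 0.
Proof. by have := anormZ 0 (0 : A); rewrite scale0r Normc.normc0 mul0r. Qed.

Lemma anormN (x : A) : anorm (- x) = anorm x.
Proof. by rewrite -scaleN1r anormZ normcN Normc.normc1 mul1r. Qed.

Lemma anorm_ge0 (x : A) : 0 <= anorm x.
Proof.
by have := anormD x (- x); rewrite subrr anorm0 anormN -mulr2n pmulrn_lge0.
Qed.

Local Notation Ae := (unitization A).

Definition ue_act (u : Ae) (x : A) : A := u.1 ** x + (u.2 : R[i]) *: x.

Definition op_norm (u : Ae) : R :=
  sup [set anorm (ue_act u x) | x in [set x | anorm x <= 1]].

Definition l1_norm (u : Ae) : R := anorm u.1 + normc u.2.

Lemma normc_ge0 (z : R[i]) : 0 <= normc z.
Proof. by case: z => a b; rewrite /= Num.Theory.sqrtr_ge0. Qed.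

Lemma l1_norm_ge0 u : 0 <= l1_norm u.
Proof. by rewrite addr_ge0 ?anorm_ge0 ?normc_ge0. Qed.

Lemma ue_act_l1 u x : anorm (ue_act u x) <= l1_norm u * anorm x.
Proof.
rewrite (le_trans (anormD _ _))// mulrDl anormZ lerD2r.
exact: anormM.
Qed.

Lemma op_norm_ub u (x : A) : anorm x <= 1 -> anorm (ue_act u x) <= op_norm u.
Proof.
move=> x1; apply: ub_le_sup; last by exists x.
exists (l1_norm u) => _ [y y1 <-]; apply: le_trans (ue_act_l1 u y) _.
by rewrite ler_piMr// l1_norm_ge0.
Qed.

Lemma op_norm_le u M :
  (forall x : A, anorm x <= 1 -> anorm (ue_act u x) <= M) -> op_norm u <= M.
Proof.
move=> uM; apply: ge_sup; last by move=> _ [x x1 <-]; exact: uM.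
by exists (anorm (ue_act u 0)), 0 => //=; rewrite anorm0.
Qed.

Lemma ue_actZl (z : R[i]) u x : ue_act (z *: u) x = z *: ue_act u x.
Proof. by rewrite /ue_act numulZl scalerDr scalerA. Qed.

Lemma ue_actZr (z : R[i]) u x : ue_act u (z *: x) = z *: ue_act u x.
Proof. by rewrite /ue_act numulZr scalerDr !scalerA mulrC. Qed.

Lemma ue_actM u v x : ue_act (u ** v) x = ue_act u (ue_act v x).
Proof.
rewrite /ue_act /= !numulDl !numulDr !scalerDr !numulZl !numulZr.
rewrite !numulA !scalerA.
by rewrite !addrA [LHS](ACl (1*3*2*4)).
Qed.

Lemma op_norm_ge0 u : 0 <= op_norm u.
Proof.
by apply: le_trans (op_norm_ub u (x := 0) _); rewrite ?anorm_ge0 ?anorm0.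
Qed.

Lemma ue_act_op u x : anorm (ue_act u x) <= op_norm u * anorm x.
Proof.
have [x0|x0] := eqVneq (anorm x) 0.
  by rewrite x0 mulr0; apply: le_trans (ue_act_l1 u x) _; rewrite x0 mulr0.
have xp : 0 < anorm x by rewrite lt_def x0 anorm_ge0.
have nx : normc ((anorm x)^-1)%:C%C = (anorm x)^-1.
  by rewrite /= expr0n addr0 sqrtr_sqr ger0_norm// invr_ge0 ltW.
have := @op_norm_ub u (((anorm x)^-1)%:C%C *: x).
rewrite ue_actZr !anormZ nx mulVf// => /(_ (lexx _)).
by rewrite -ler_pdivlMl ?invr_gt0// invrK mulrC.
Qed.

Lemma op_norm_le_l1 u : op_norm u <= l1_norm u.
Proof.
apply: op_norm_le => x x1; apply: le_trans (ue_act_l1 u x) _.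
by rewrite ler_piMr// l1_norm_ge0.
Qed.

Lemma op_normD u v : op_norm (u + v) <= op_norm u + op_norm v.
Proof.
apply: op_norm_le => x x1.
have -> : ue_act (u + v) x = ue_act u x + ue_act v x.
  by rewrite /ue_act numulDl scalerDl addrACA.
by apply: le_trans (anormD _ _) _; rewrite lerD// op_norm_ub.
Qed.

Lemma op_normZ (z : R[i]) u : op_norm (z *: u) = normc z * op_norm u.
Proof.
have le z' u' : op_norm (z' *: u') <= normc z' * op_norm u'.
  apply: op_norm_le => x x1; rewrite ue_actZl anormZ ler_wpM2l ?normc_ge0//.
  exact: op_norm_ub.
apply/eqP; rewrite eq_le le /=.
have [->|z0] := eqVneq z 0.
  by rewrite Normc.normc0 mul0r op_norm_ge0.
have n0 : 0 < normc z.
  rewrite lt_def normc_ge0 andbT; apply: contra z0 => /eqP /Normc.eq0_normc ->.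
  exact: eqxx.
have := le z^-1 (z *: u).
by rewrite scalerA mulVf// scale1r Normc.normcV -ler_pdivrMl ?invr_gt0// invrK.
Qed.

Lemma op_normM u v : op_norm (u ** v) <= op_norm u * op_norm v.
Proof.
apply: op_norm_le => x x1; rewrite ue_actM.
apply: le_trans (ue_act_op u _) _; rewrite ler_wpM2l ?op_norm_ge0//.
exact: op_norm_ub.
Qed.

Lemma l1_normD u v : l1_norm (u + v) <= l1_norm u + l1_norm v.
Proof. by rewrite addrACA lerD ?anormD// le_normcD. Qed.

Lemma l1_normZ (z : R[i]) u : l1_norm (z *: u) = normc z * l1_norm u.
Proof. by rewrite /l1_norm anormZ Normc.normcM mulrDr. Qed.

Lemma l1_normM u v : l1_norm (u ** v) <= l1_norm u * l1_norm v.
Proof.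
rewrite /l1_norm /= Normc.normcM mulrDl !mulrDr addrA lerD2r.
apply: le_trans (anormD _ _) _; rewrite anormZ.
apply: le_trans (lerD (anormD _ _) (lexx _)) _; rewrite anormZ.
rewrite [normc v.2 * _]mulrC [leRHS]addrAC lerD2r lerD2r.
exact: anormM.
Qed.

End SemiNormTheory.
End Norms.

(* Aliases of A and A_e, so that each can carry its own norms: alg_op A is
   A^op = (A, op_norm), ue_op A is A_e^op and ue_l1 A is A_e^1. *)
Definition alg_op (R : realType) (A : semiNormedAlgType R) : Type := A.
Definition ue_op (R : realType) (A : semiNormedAlgType R) : Type :=
  unitization A.
Definition ue_l1 (R : realType) (A : semiNormedAlgType R) : Type :=
  unitization A.

Section NormedUnitizations.
Variables (R : realType) (A : semiNormedAlgType R).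

Definition alg_op_norm (a : A) : R := op_norm (ue_inj a).

Fact alg_op_normD a b : alg_op_norm (a + b) <= alg_op_norm a + alg_op_norm b.
Proof.
apply: le_trans (op_normD _ _).
by rewrite /alg_op_norm /ue_inj -[in leLHS](addr0 0).
Qed.

Fact alg_op_normZ (z : R[i]) a : alg_op_norm (z *: a) = normc z * alg_op_norm a.
Proof.
by rewrite -op_normZ /alg_op_norm /ue_inj -[in LHS](scaler0 _ z).
Qed.

Fact alg_op_normM a b : alg_op_norm (a ** b) <= alg_op_norm a * alg_op_norm b.
Proof. by rewrite /alg_op_norm ue_injM op_normM. Qed.

HB.instance Definition _ := NuAlgebra.copy (alg_op A) A.
HB.instance Definition _ := NuAlgebra_isSemiNormed.Build R (alg_op A)
  alg_op_normD alg_op_normZ alg_op_normM.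

HB.instance Definition _ := NuAlgebra.copy (ue_op A) (unitization A).
HB.instance Definition _ := NuAlgebra_isSemiNormed.Build R (ue_op A)
  (@op_normD R A) (@op_normZ R A) (@op_normM R A).

HB.instance Definition _ := NuAlgebra.copy (ue_l1 A) (unitization A).
HB.instance Definition _ := NuAlgebra_isSemiNormed.Build R (ue_l1 A)
  (@l1_normD R A) (@l1_normZ R A) (@l1_normM R A).

End NormedUnitizations.

Section Definiteness.
Variables (R : realType) (A : normedAlgType R).

Fact l1_norm_eq0 (u : ue_l1 A) : anorm u = 0 -> u = 0.
Proof.
case: u => a k /eqP; rewrite paddr_eq0 ?anorm_ge0 ?normc_ge0//.
by move=> /andP[/eqP /anorm0_eq0 /= -> /eqP /Normc.eq0_normc /= ->].
Qed.

HB.instance Definition _ :=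
  SemiNormedAlgebra_isDefinite.Build R (ue_l1 A) l1_norm_eq0.

Lemma op_norm0_act (u : unitization A) x : op_norm u = 0 -> ue_act u x = 0.
Proof.
move=> u0; apply: anorm0_eq0; apply/eqP; rewrite eq_le anorm_ge0 andbT.
by have := ue_act_op u x; rewrite u0 mul0r.
Qed.

Lemma alg_op_norm_eq0 : faithful A ->
  forall a : alg_op A, anorm a = 0 -> a = 0.
Proof.
move=> fA a a0; apply: fA => x.
by have := op_norm0_act x a0; rewrite /ue_act /= scale0r addr0.
Qed.

Lemma ue_op_norm_eq0 : faithful A -> ~ (exists e : A, forall x, e ** x = x) ->
  forall u : ue_op A, anorm u = 0 -> u = 0.
Proof.
move=> fA noid [a k] u0.
have act0 x : a ** x + (k : R[i]) *: x = 0 := op_norm0_act x u0.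
have k0 : k = 0.
  apply: contra_notP noid => /eqP k0; exists (- (k : R[i])^-1 *: a) => x.
  have ax : a ** x = - ((k : R[i]) *: x) by apply/eqP; rewrite -addr_eq0 act0.
  by rewrite numulZl ax scaleNr scalerN opprK scalerA mulVf// scale1r.
move: act0; rewrite k0 => act0; congr (_, _); apply: fA => x.
by have := act0 x; rewrite scale0r addr0.
Qed.

End Definiteness.

Section NumericalRange.
Variables (R : realType) (B : semiNormedAlgType R).
Implicit Types (f : {linear B -> R[i]^o}) (b x : B).

Definition bounded_functional f :=
  exists M : R, forall y, normc (f y) <= M * anorm y.

Definition dual_norm f : R :=
  sup [set normc (f y) | y in [set y | anorm y <= 1]].

Definition unit_sphere : set B := [set x | anorm x = 1].

Definition support_functionals x : set {linear B -> R[i]^o} :=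
  [set f | [/\ bounded_functional f, dual_norm f = 1 & f x = 1]].

Definition num_range_at b x : set R[i] :=
  [set f (b ** x) | f in support_functionals x].

Definition num_range b : set R[i] :=
  \bigcup_(x in unit_sphere) num_range_at b x.

End NumericalRange.

Arguments num_range_at {R} B b x.
Arguments num_range {R} B b.

(* [R[i]^o] carries the topology of R[i] and [Rcomplex R] its structure of real
   vector space. *)
Definition closed_convex_hull (R : realType) (K : set R[i]) : set R[i] :=
  \bigcap_(C in [set C : set R[i] | [/\ closed (C : set R[i]^o),
      convex_set (C : set (convex_lmodType (Rcomplex R))) & K `<=` C]]) C.

(* Main.v *)
Require Import Defs.
From HB Require Import structures.
From mathcomp Require Import all_boot all_order all_algebra complex.
From mathcomp Require Import all_classical all_reals all_analysis.
From mathcomp Require Import ring lra.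

Set Implicit Arguments.
Unset Strict Implicit.
Unset Printing Implicit Defensive.

Import Order.TTheory GRing.Theory Num.Theory.
Import numFieldNormedType.Exports.
Local Open Scope classical_set_scope.
Local Open Scope ring_scope.

(* If ||x|| = 1, then by Hahn-Banach z lies in V_B(b; x) if and only if
   |s + t z| <= ||s x + t b x|| for all scalars s and t. In this form V_B(b; x)
   is visibly closed and convex, and every inclusion of the theorem except
   V_{A_e^op}(a; 1) in co V_A(a) follows by comparing the norms on the right.

   For that inclusion, let z in V_{A_e^op}(a; 1) lie outside a closed convex set
   containing V_A(a). A separating functional gives u in C and d > 0 such that
   Re V_A(b) <= w := Re (u z) - d, where b = u a. Then b - w is dissipative:
   ||y - t b y|| >= (1 - t w) ||y|| for t >= 0. With y = (1 + t b) x this gives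
   (1 - t w) ||1 + t b||_op <= 1 + t^2 ||b||^2, whereas
   ||1 + t b||_op >= Re (1 + t u z) = 1 + t (w + d), absurd for small t.

   Hahn-Banach and the separation theorem both come from the fact that the
   pointwise infimum of a suitable family of functionals is sublinear. *)

(** * Sublinear functionals and the real Hahn-Banach theorem *)

Section HahnBanach.
Variables (R : realType) (V : lmodType R).
Implicit Types (p q : V -> R) (x y : V).

(** Homogeneity as an inequality passes easily to infima; applied to [t^-1] as well, it gives
    equality. *)
Definition sublinear p :=
  (forall x y, p (x + y) <= p x + p y) /\
  (forall (t : R) x, 0 < t -> p (t *: x) <= t * p x).

Lemma sublinearZ p (t : R) x : sublinear p -> 0 < t -> p (t *: x) = t * p x.
Proof.
move=> [_ pZ] t0; apply/eqP; rewrite eq_le pZ//=.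
have := pZ t^-1 (t *: x); rewrite scalerA mulVf ?gt_eqF// scale1r invr_gt0.
by move=> /(_ t0); rewrite -ler_pdivrMl ?invr_gt0// invrK.
Qed.

Lemma sublinear0 p : sublinear p -> p 0 = 0.
Proof.
move=> sp; have := @sublinearZ p 2 0 sp (ltr0n _ 2); rewrite scaler0.
by lra.
Qed.

Lemma sublinear_geN p x : sublinear p -> - p (- x) <= p x.
Proof.
move=> sp; have := sp.1 x (- x); rewrite subrr sublinear0//.
by lra.
Qed.

(** [q] is the pointwise infimum, finite thanks to [i0] and the lower bound [- p]. Since [k] may
    depend on the vectors, a single [F i] may fail to be sublinear. *)
Lemma sublinear_inf (I : Type) (F : I -> V -> R) (i0 : I) (p : V -> R) :
  (forall i x, - p x <= F i x) ->
  (forall i j x y, exists k, F k (x + y) <= F i x + F j y) ->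
  (forall i (t : R) x, 0 < t -> exists k, F k (t *: x) <= t * F i x) ->
  exists q, [/\ sublinear q, forall i x, q x <= F i x &
    forall x, - p x <= q x].
Proof.
move=> Fp FD FZ; pose q x := inf [set F i x | i in setT].
have hinf x : has_inf [set F i x | i in setT].
  by split; [exists (F i0 x), i0|exists (- p x) => _ [i _ <-]].
have qF i x : q x <= F i x by apply: ge_inf; [exact: (hinf x).2|exists i].
have qlb M x : (forall i, M <= F i x) -> M <= q x.
  by move=> MF; apply: lb_le_inf => [|_ [i _ <-]//]; exact: (hinf x).1.
exists q; split => //; last by move=> x; exact: qlb.
split=> [x y|t x t0].
  rewrite -lerBlDr; apply: (qlb) => i; rewrite lerBlDr -lerBlDl.
  apply: qlb => j; rewrite lerBlDl; have [k] := FD i j x y.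
  exact: le_trans.
rewrite -ler_pdivrMl//; apply: qlb => i; rewrite ler_pdivrMl//.
by have [k] := FZ i t x t0; exact: le_trans.
Qed.

(** Zorn's lemma for the reversed pointwise order: a nonempty chain is bounded by its pointwise
    infimum. *)
Lemma sublinear_minimal p : sublinear p -> exists q,
  [/\ sublinear q, forall x, q x <= p x &
    forall r, sublinear r -> (forall x, r x <= q x) -> r = q].
Proof.
move=> sp; pose T := {q | sublinear q /\ forall x, q x <= p x}.
pose le (q r : T) := `[< forall x, sval r x <= sval q x >].
have [||A totA|[q [sq qp]] qmin] :=
  @ZL_preorder T (exist _ p (conj sp (fun=> lexx _))) le.
- by move=> q; apply/asboolP.
- by move=> q r s /asboolP qr /asboolP rs; apply/asboolP => x;
  apply: le_trans (qr x).
- have [[q0 Aq0]|A0] := pselect (A !=set0); last first.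
    by exists (exist _ p (conj sp (fun=> lexx _))) => s As; case: A0; exists s.
  have [i x|i j x y|i t x t0|q [sq qF qp]] :=
      @sublinear_inf {q : T | A q} (fun i => sval (sval i)) (exist _ q0 Aq0)
        (fun x => p (- x)).
  (* The infimum is finite because [- p (- x) <= - r (- x) <= r x]. *)
  + case: i => -[r [sr rp]] _ /=.
    by rewrite (le_trans _ (sublinear_geN x sr))// lerN2.
  + case: i j => [i Ai] [j Aj].
    have [/asboolP ij|/asboolP ji] := totA _ _ Ai Aj.
      exists (exist _ j Aj) => /=; rewrite (le_trans ((svalP j).1.1 _ _))//.
      by rewrite lerD2r.
    exists (exist _ i Ai) => /=; rewrite (le_trans ((svalP i).1.1 _ _))//.
    by rewrite lerD2l.
  + by exists i; apply: (svalP (sval i)).1.2.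
  + have qp' x : q x <= p x.
      exact: le_trans (qF (exist _ q0 Aq0) x) ((svalP q0).2 x).
    exists (exist _ q (conj sq qp')) => s As; apply/asboolP => x /=.
    exact: (qF (exist _ s As) x).
- exists q; split => // r sr rq.
  have rp x : r x <= p x by apply: le_trans (qp x).
  apply/funext => x; apply/eqP; rewrite eq_le rq /=.
  have /asboolP := qmin (exist _ r (conj sr rp)) (introT (asboolP _) rq).
  exact.
Qed.

(* Minimality of q is tested against inf_(t >= 0) q (y + t x) - t q x. *)
Lemma hahn_banach p : sublinear p ->
  exists g : {linear V -> R^o}, forall x, g x <= p x.
Proof.
move=> /sublinear_minimal[q [sq qp qmin]].
have qD x y : q (x + y) = q x + q y.
  apply/eqP; rewrite eq_le sq.1 /=.
  pose F (t : {t : R | 0 <= t}) z := q (z + sval t *: x) - sval t * q x.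
  have tq (t : R) : 0 <= t -> q (t *: x) = t * q x.
    rewrite le_eqVlt => /predU1P[<-|t0]; last exact: sublinearZ.
    by rewrite scale0r mul0r sublinear0.
  have [t z|s t z z'|s t z t0|r [sr rF _]] :=
    @sublinear_inf _ F (exist _ 0 (lexx 0)) (fun z => q (- z)).
  - rewrite /F -tq ?(svalP t)//.
    by have := sq.1 (z + sval t *: x) (- z); rewrite addrC addKr; lra.
  - exists (exist _ (sval s + sval t) (addr_ge0 (svalP s) (svalP t))).
    rewrite /F /= scalerDl addrACA mulrDl opprD [leRHS]addrACA lerD2r.
    exact: sq.1.
  - exists (exist _ (t * sval s) (mulr_ge0 (ltW t0) (svalP s))).
    by rewrite /F /= -scalerA -scalerDr sublinearZ// -mulrA -mulrBr.
  - have rq : r = q.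
      apply: qmin => // z; apply: le_trans (rF (exist _ 0 (lexx 0)) z) _.
      by rewrite /F /= scale0r addr0 mul0r subr0.
    (* The index [t = 1] turns [r = q] into [q y <= q (y + x) - q x]. *)
    have := rF (exist _ 1 ler01) y.
    by rewrite rq /F /= scale1r mul1r [y + x]addrC; lra.
have qN x : q (- x) = - q x.
  by apply/eqP; rewrite -subr_eq0 opprK addrC -qD subrr sublinear0.
have qZ (t : R) x : q (t *: x) = t * q x.
  have [t0|t0|->] := ltgtP t 0; last by rewrite scale0r mul0r sublinear0.
    by rewrite -[t]opprK scaleNr qN sublinearZ ?oppr_gt0//; ring.
  exact: sublinearZ.
have lq : linear (q : V -> R^o) by move=> t x y; rewrite qD qZ.
pose L := GRing.isLinear.Build _ _ _ _ (q : V -> R^o) lq.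
pose g : {linear V -> R^o} := HB.pack (q : V -> R^o) L.
by exists g.
Qed.

End HahnBanach.

(** * Moduli and real parts of complex numbers *)

Section ComplexModulus.
Variable R : realType.
Implicit Types z : R[i].

Lemma normc_real (t : R) : normc t%:C%C = `|t|.
Proof. by rewrite /= expr0n addr0 sqrtr_sqr. Qed.

Lemma Re_le_normc z : complex.Re z <= normc z.
Proof.
case: z => x y /=; rewrite (le_trans (ler_norm x))// -sqrtr_sqr.
by rewrite ler_wsqrtr// lerDl sqr_ge0.
Qed.

(** Used to turn bounds on real parts into bounds on moduli. *)
Lemma normc_rotation z : exists2 u, normc u = 1 & u * z = (normc z)%:C%C.
Proof.
have [->|z0] := eqVneq z 0.
  by exists 1; rewrite ?Normc.normc1// mulr0 Normc.normc0.
have n0 : normc z != 0 by apply: contra z0 => /eqP/Normc.eq0_normc ->.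
exists ((normc z)%:C%C / z); last by rewrite mulfVK.
by rewrite Normc.normcM Normc.normcV normc_real ger0_norm ?normc_ge0// divff.
Qed.

Lemma ReD z1 z2 : complex.Re (z1 + z2) = complex.Re z1 + complex.Re z2.
Proof. by case: z1 z2 => [? ?] []. Qed.

Lemma ReN z : complex.Re (- z) = - complex.Re z.
Proof. by case: z. Qed.

Lemma ReZ (t : R) z : complex.Re (t%:C%C * z) = t * complex.Re z.
Proof. by case: z => x y /=; rewrite mul0r subr0. Qed.

End ComplexModulus.

(** * Restriction of scalars, which makes the real Hahn-Banach theorem applicable *)

Definition realification (R : realType) (V : lmodType R[i]) : Type := V.

Section Realification.
Variables (R : realType) (V : lmodType R[i]).

HB.instance Definition _ := GRing.Zmodule.on (realification V).

Let scale (t : R) (x : realification V) : realification V :=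
  (t%:C%C : R[i]) *: (x : V).

Let scaleA t t' x : scale t (scale t' x) = scale (t * t') x.
Proof. by rewrite /scale scalerA rmorphM. Qed.

Let scale1 : left_id 1 scale.
Proof. by move=> x; rewrite /scale rmorph1 scale1r. Qed.

Let scaleDr : right_distributive scale +%R.
Proof. by move=> t x y; rewrite /scale scalerDr. Qed.

Let scaleDl x : {morph scale^~ x : t t' / t + t'}.
Proof. by move=> t t'; rewrite /scale rmorphD scalerDl. Qed.

HB.instance Definition _ := GRing.Zmodule_isLmodule.Build R (realification V)
  scaleA scale1 scaleDr scaleDl.

Lemma realification_scaleE (t : R) (x : V) :
  t *: (x : realification V) = (t%:C%C : R[i]) *: x.
Proof. by []. Qed.

End Realification.

(** * The complex Hahn-Banach theorem for seminorms *)

Section ComplexHahnBanach.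
Variables (R : realType) (V W : lmodType R[i]) (p : V -> R).
Variables (i : W -> V) (phi : W -> R[i]^o).
Hypothesis pD : forall x y, p (x + y) <= p x + p y.
Hypothesis pZ : forall (z : R[i]) x, p (z *: x) = normc z * p x.
Hypothesis ilin : linear i.
Hypothesis philin : linear phi.
Hypothesis phip : forall w, normc (phi w) <= p (i w).

Let p0 : p 0 = 0.
Proof. by rewrite -(scale0r (0 : V)) pZ Normc.normc0 mul0r. Qed.

Let pN x : p (- x) = p x.
Proof. by rewrite -scaleN1r pZ normcN Normc.normc1 mul1r. Qed.

Let iZ (z : R[i]) w : i (z *: w) = z *: i w.
Proof. exact: (scalable_linear ilin). Qed.

Let phiZ (z : R[i]) w : phi (z *: w) = z * phi w.
Proof. exact: (scalable_linear philin). Qed.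

(* Any real functional below inf_w (p (y + i w) - Re (phi w)) is dominated by p
   and extends Re phi. *)
Let hahn_banach_Re : exists g : {linear realification V -> R^o},
  (forall w, g (i w) = complex.Re (phi w)) /\ (forall x, g x <= p x).
Proof.
have [w x|w w' x y|w t x t0|q [sq qF _]] := @sublinear_inf R (realification V)
    W (fun w y => p (y + i w) - complex.Re (phi w)) 0 p.
- have := pD (x + i w) (- x); rewrite addrC addKr pN.
  by have := Re_le_normc (phi w); have := phip w; lra.
- exists (w + w'); have := ilin 1 w w'; have := philin 1 w w'.
  rewrite !scale1r => -> ->; rewrite ReD [x + y + _]addrACA.
  by have := pD (x + i w) (y + i w'); lra.
- exists (t%:C%C *: w); rewrite iZ phiZ ReZ realification_scaleE -scalerDr pZ.
  by rewrite normc_real gtr0_norm// mulrBr.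
have [g gq] := hahn_banach sq.
(* At [- i w] the seminorm term of index [w] vanishes; replacing [w] by its opposite will give the
   reverse inequality. *)
have gRe w : complex.Re (phi w) <= g (i w).
  have := le_trans (gq (- i w)) (qF w (- i w)).
  by rewrite addNr p0 raddfN; lra.
exists g; split=> [w|x]; last first.
  have := le_trans (gq x) (qF 0 x).
  by rewrite -(scale0r 0) iZ phiZ !scale0r mul0r addr0 subr0.
apply/eqP; rewrite eq_le gRe andbT.
have := gRe (-1 *: w); rewrite iZ phiZ mulN1r ReN scaleN1r raddfN.
by lra.
Qed.

(** The subspace is the image of [i], which may have a kernel: the bound by [p] makes [phi] vanish
    there. *)
Lemma complex_hahn_banach : exists f : {linear V -> R[i]^o},
  (forall w, f (i w) = phi w) /\ (forall x, normc (f x) <= p x).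
Proof.
have [g [gi gp]] := hahn_banach_Re.
have gZ (t : R) (x : V) : g ((t%:C%C : R[i]) *: x) = t * g x.
  by rewrite -realification_scaleE linearZ.
(* The complex linear functional with real part [g]. *)
pose f (x : V) : R[i]^o := (g x +i* (- g ('i%C *: x)%R))%C.
have flin : linear f.
  move=> [s t] x y; rewrite /f.
  have gc z : g ((s +i* t)%C *: z) = s * g z + t * g ('i%C *: z).
    rewrite [in LHS](complexE (s +i* t)%C) /= scalerDl [_ * _%:C%C]mulrC.
    by rewrite -scalerA raddfD /= !gZ.
  have gi2 z : g ('i%C *: ('i%C *: z)) = - g z.
    by rewrite scalerA -expr2 sqr_i scaleN1r raddfN.
  rewrite scalerDr !raddfD /= gc scalerA [_ * (s +i* t)%C]mulrC -scalerA gc gi2.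
  apply/eqP; rewrite eq_complex /=; apply/andP; split; apply/eqP; ring.
pose L := GRing.isLinear.Build _ _ _ _ f flin.
pose F : {linear V -> R[i]^o} := HB.pack f L.
exists F; split=> [w|x].
  apply/eqP; rewrite eq_complex /= gi eqxx /= -iZ gi phiZ.
  by case: (phi w) => x y /=; apply/eqP; ring.
(* After this rotation [F (u *: x)] is real, hence equal to [g (u *: x)], which is at most
   [p (u *: x) = p x]. *)
have [u u1 ux] := normc_rotation (F x).
have : g (u *: x) = normc (F x).
  have -> : g (u *: x) = complex.Re (F (u *: x)) by [].
  by rewrite linearZ /= [X in complex.Re X]ux.
by move=> <-; rewrite -[leRHS]mul1r -u1 -pZ.
Qed.

End ComplexHahnBanach.

(** * Closed and convex sets of complex numbers *)

Section ComplexSets.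
Variable R : realType.
Implicit Types (C : set R[i]) (z : R[i]).

(** Balls of [R[i]^o] have radii in [R[i]], but a positive element of [R[i]] is real, so radii in
    [R] suffice. *)
Lemma closed_normcP C : closed (C : set R[i]^o) <->
  forall z, (forall e : R, 0 < e -> exists2 c, C c & normc (c - z) < e) -> C z.
Proof.
split=> [cC z Cz|Cz z cz].
  apply: cC => U /nbhs_normP[e /= e0 eU].
  have [e1 e2] : complex.Im e = 0 /\ 0 < complex.Re e.
    by move: e0; rewrite ltcE => /andP[/eqP].
  have [c Cc cz] := Cz _ e2; exists c; split=> //; apply: eU.
  rewrite /= distrC /Num.norm /=.
  by case: e e1 cz {e0 e2} => s t /= -> cz; rewrite ltcR.
apply: Cz => e e0.
have [] := cz (ball (z : R[i]^o) e%:C%C).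
  by apply: nbhsx_ballx; rewrite ltcR.
move=> c [Cc]; rewrite -ball_normE /= distrC => ce; exists c => //.
by rewrite -ltcR.
Qed.

Lemma convex_set_complex C :
  convex_set (C : set (convex_lmodType (Rcomplex R))) <->
  forall c c' (t : R), 0 <= t <= 1 -> C c -> C c' ->
    C (t%:C%C * c + (1 - t)%:C%C * c').
Proof.
have convE (t : {i01 R}) (c c' : R[i]) :
    conv t (c : convex_lmodType (Rcomplex R)) c' =
      (t%:num)%:C%C * c + (1 - t%:num)%:C%C * c'.
  rewrite -[LHS]/(t%:num *: (c : Rcomplex R) +
    (1 - t%:num) *: (c' : Rcomplex R)).
  case: c c' => [x y] [x' y']; apply/eqP; rewrite eq_complex /=.
  by apply/andP; split; apply/eqP; ring.
split=> [cC c c' t t01 Cc Cc'|cC c c' t]; last first.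
  rewrite !inE convE => Cc Cc'; apply: cC => //.
  by rewrite ge0 /=; exact: le1.
have := cC c c' (Itv01 (proj1 (andP t01)) (proj2 (andP t01))).
by rewrite !inE convE; exact.
Qed.

End ComplexSets.

(** * The numerical range at one vector, described by norm inequalities *)

Section NumericalRangeAt.
Variables (R : realType) (B : semiNormedAlgType R).
Implicit Types (b x : B) (f : {linear B -> R[i]^o}).
Local Open Scope nualg_scope.

Lemma anorm1_neq0 x : anorm x = 1 -> x != 0.
Proof. by apply: contra_eq_neq => ->; rewrite anorm0 eq_sym oner_eq0. Qed.

Lemma support_functional_le x f y :
  support_functionals x f -> normc (f y) <= anorm y.
Proof.
move=> [[M fM] f1 _].
(* A null vector of the seminorm cannot be normalized; boundedness gives [f y = 0] there. *)
have [y0|y0] := eqVneq (anorm y) 0.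
  by have := fM y; rewrite y0 mulr0.
have yp : 0 < anorm y by rewrite lt_def y0 anorm_ge0.
have ny : normc ((anorm y)^-1)%:C%C = (anorm y)^-1.
  by rewrite normc_real ger0_norm// invr_ge0 ltW.
have : normc (f (((anorm y)^-1)%:C%C *: y)) <= 1.
  rewrite -f1; apply: ub_le_sup.
    exists `|M| => _ [u u1 <-]; apply: le_trans (fM u) _.
    rewrite (le_trans (ler_norm _))// normrM ler_piMr//.
    by rewrite ger0_norm// anorm_ge0.
  by exists (((anorm y)^-1)%:C%C *: y) => //=; rewrite anormZ ny mulVf.
by rewrite linearZ Normc.normcM ny ler_pdivrMl// mulr1.
Qed.

Lemma support_functionalsP x f : anorm x = 1 ->
  (forall y, normc (f y) <= anorm y) -> f x = 1 -> support_functionals x f.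
Proof.
move=> x1 f1 fx; split=> //; first by exists 1 => y; rewrite mul1r.
apply/eqP; rewrite eq_le; apply/andP; split.
  apply: ge_sup; first by exists (normc (f x)), x => //=; rewrite x1.
  by move=> _ [y y1 <-]; exact: le_trans (f1 y) y1.
rewrite -[leLHS](@Normc.normc1 R) -fx; apply: ub_le_sup; last first.
  by exists x => //=; rewrite x1.
by exists 1 => _ [y y1 <-]; exact: le_trans (f1 y) y1.
Qed.

(** [s + t * z] is the value at [s *: x + t *: (b ** x)] of a functional of norm 1. *)
Lemma num_range_at_le b x z (s t : R[i]) :
  num_range_at B b x z -> normc (s + t * z) <= anorm (s *: x + t *: (b ** x)).
Proof.
move=> [f xf <-]; have [_ _ fx] := xf.
rewrite (le_trans _ (support_functional_le _ xf))//.
by rewrite linearD !linearZ /= fx [s *: _]mulr1.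
Qed.

Lemma num_range_atE b x : anorm x = 1 -> num_range_at B b x =
  [set z | forall s t, normc (s + t * z) <= anorm (s *: x + t *: (b ** x))].
Proof.
move=> x1; apply/seteqP; split=> z.
  by move=> xz s t; exact: num_range_at_le.
move=> zle.
(* Pairs of scalars parametrize the span of [x] and [b ** x], whether or not these are
   independent. *)
pose i (w : (R[i]^o * R[i]^o)%type) : B :=
  (w.1 : R[i]) *: x + (w.2 : R[i]) *: (b ** x).
pose phi (w : (R[i]^o * R[i]^o)%type) : R[i]^o := w.1 + w.2 * z.
have ilin : linear i.
  by move=> k w w'; rewrite /i /= !scalerDl scalerDr !scalerA addrACA.
have philin : linear phi.
  move=> k [s t] [s' t']; rewrite /phi /=.
  rewrite /GRing.scale /=.
  by ring.
have [//|//|w|f [fi f1]] :=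
  @complex_hahn_banach _ B _ (@anorm R B) i phi _ _ ilin philin.
- exact: anormD.
- exact: anormZ.
- exact: zle.
have fx : f x = 1.
  by have := fi (1, 0); rewrite /i /phi /= scale1r scale0r addr0 mul0r addr0.
exists f; first exact: support_functionalsP.
by have := fi (0, 1); rewrite /i /phi /= scale1r scale0r add0r mul1r add0r.
Qed.

(** The functional sending [s *: x] to [s] on the line through [x] extends with norm 1. *)
Lemma num_range_at_nonempty b x : anorm x = 1 -> num_range_at B b x !=set0.
Proof.
move=> x1.
pose i (w : R[i]^o) : B := (w : R[i]) *: x.
have ilin : linear i.
  by move=> k w w'; rewrite /i scalerDl scalerA.
have [//|//|//|w|f [fi f1]] :=
  @complex_hahn_banach _ B R[i]^o (@anorm R B) i id _ _ ilin.
- exact: anormD.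
- exact: anormZ.
- by rewrite anormZ x1 mulr1.
have fx : f x = 1.
  by have := fi 1; rewrite /i scale1r.
by exists (f (b ** x)), f => //; exact: support_functionalsP.
Qed.

Lemma num_range_at_closed b x : anorm x = 1 ->
  closed (num_range_at B b x : set R[i]^o).
Proof.
move=> x1; apply/closed_normcP => z; rewrite num_range_atE// => zb s t.
apply/ler_addgt0Pr => e e0.
(* The [+ 1] keeps the denominator positive when [t = 0]. *)
have [] := zb (e / (normc t + 1)).
  by rewrite divr_gt0// ltr_wpDl ?normc_ge0.
move=> c /(_ s t) cb cz.
have -> : s + t * z = s + t * c + - (t * (c - z)) by ring.
rewrite (le_trans (le_normcD _ _))// normcN Normc.normcM lerD//.
have t1 : 0 < normc t + 1 by rewrite ltr_wpDl ?normc_ge0.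
move: cz; rewrite ltr_pdivlMr// => cz; rewrite (le_trans _ (ltW cz))//.
by rewrite mulrC ler_wpM2l ?normc_ge0// lerDl.
Qed.

Lemma num_range_at_convex b x : anorm x = 1 ->
  convex_set (num_range_at B b x : set (convex_lmodType (Rcomplex R))).
Proof.
move=> x1; apply/convex_set_complex => c c' r /andP[r0 r1].
rewrite num_range_atE// => cb cb' s t.
have -> : s + t * (r%:C%C * c + (1 - r)%:C%C * c') =
    r%:C%C * (s + t * c) + (1 - r)%:C%C * (s + t * c').
  by rewrite rmorphB rmorph1; ring.
rewrite (le_trans (le_normcD _ _))// !Normc.normcM !normc_real.
rewrite ger0_norm// ger0_norm ?subr_ge0//.
have := ler_wpM2l r0 (cb s t).
have r2 : 0 <= 1 - r by rewrite subr_ge0.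
by have := ler_wpM2l r2 (cb' s t); lra.
Qed.

End NumericalRangeAt.

(** * Strict separation of a point from a closed convex set *)

Section Separation.
Variables (R : realType) (C : set R[i]) (z : R[i]).
Hypotheses (C0 : C !=set0) (clC : closed (C : set R[i]^o)) (nCz : ~ C z).
Hypothesis cvC : convex_set (C : set (convex_lmodType (Rcomplex R))).

Let far : exists2 d : R, 0 < d & forall c, C c -> d <= normc (z - c).
Proof.
apply: contra_notP nCz => nd; apply: (iffLR (closed_normcP C) clC) => e e0.
apply: contra_notP nd => ne; exists e => // c Cc.
rewrite leNgt; apply/negP => ce.
by apply: ne; exists c => //; rewrite -normcN opprB.
Qed.

(* With d the distance from z to C, a functional g dominated by
   inf_(s > 0, c in C) (|y - s (z - c)| - s d) satisfies g (z - c) <= - d. *)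
Lemma strict_separation : exists (u : R[i]) (d : R), 0 < d /\
  forall c, C c -> complex.Re (u * c) <= complex.Re (u * z) - d.
Proof.
have [d d0 dC] := far; have [c0 Cc0] := C0.
pose I := {w : R * R[i] | 0 < w.1 /\ C w.2}.
pose mk s c s0 Cc : I := exist _ (s, c) (conj s0 Cc).
pose F (w : I) (y : Rcomplex R) : R :=
  normc (y - (sval w).1%:C%C * (z - (sval w).2)) - (sval w).1 * d.
have [[[s c] [/= s0 Cc]] y|[[s c] [/= s0 Cc]] [[s' c'] [/= s'0 Cc']] y y'|
      [[s c] [/= s0 Cc]] t y t0|q [sq qF _]] :=
  @sublinear_inf R (Rcomplex R) I F (mk 1 c0 ltr01 Cc0) (@normc R).
- rewrite /F /=.
  have := le_normcD y (- (y - s%:C%C * (z - c))).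
  rewrite subKr normcN Normc.normcM normc_real gtr0_norm//.
  by have := ler_wpM2l (ltW s0) (dC c Cc); lra.
- have ss0 : 0 < s + s' by rewrite addr_gt0.
  (* With this weight, [s + s'] times the difference of [z] and the combination of [c] and [c'] is
     [s (z - c) + s' (z - c')]; convexity keeps the combination in [C]. *)
  pose r := s / (s + s').
  have r01 : 0 <= r <= 1.
    by rewrite /r ler_pdivrMr// mul1r lerDl divr_ge0 ltW.
  have Cr := iffLR (convex_set_complex C) cvC c c' r r01 Cc Cc'.
  exists (mk (s + s') _ ss0 Cr); rewrite /F /=.
  have e1 : (s + s') * r = s by rewrite /r mulrC mulfVK// gt_eqF.
  have e2 : (s + s') * (1 - r) = s' by rewrite mulrBr e1 mulr1 addrC addKr.
  have -> : y + y' - (s + s')%:C%C * (z - (r%:C%C * c + (1 - r)%:C%C * c')) =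
      (y - s%:C%C * (z - c)) + (y' - s'%:C%C * (z - c')).
    rewrite mulrBr mulrDr !mulrA -!rmorphM e1 e2 rmorphD; ring.
  have := le_normcD (y - s%:C%C * (z - c)) (y' - s'%:C%C * (z - c')).
  by lra.
- exists (mk (t * s) c (mulr_gt0 t0 s0) Cc); rewrite /F /=.
  have -> : t *: y - (t * s)%:C%C * (z - c) = t%:C%C * (y - s%:C%C * (z - c)).
    have -> : t *: y = t%:C%C * y.
      case: y => a b; apply/eqP; rewrite eq_complex /=.
      by rewrite !mul0r subr0 addr0 !eqxx.
    by rewrite rmorphM; ring.
  by rewrite Normc.normcM normc_real gtr0_norm// [leRHS]mulrBr mulrA.
have [g gq] := hahn_banach sq.
have gd c : C c -> g (z : Rcomplex R) - g (c : Rcomplex R) <= - d.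
  move=> Cc; rewrite -raddfB; apply: le_trans (gq _) _.
  apply: le_trans (qF (mk 1 c ltr01 Cc) _) _.
  by rewrite /F /= rmorph1 !mul1r subrr Normc.normc0 sub0r.
have gZ (t : R) (x : Rcomplex R) : g (t *: x) = t * g x.
  by have := linearP g t x 0; rewrite raddf0 !addr0.
(* The values at 1 and ['i] determine [g]; the signs below make [- g] the real part of
   multiplication by [- g1 +i* gi]. *)
pose g1 := g (1 : Rcomplex R); pose gi := g ('i%C : Rcomplex R).
have gE (w : Rcomplex R) : g w = complex.Re w * g1 + complex.Im w * gi.
  have {1}-> : w = complex.Re w *: (1 : Rcomplex R) +
      complex.Im w *: ('i%C : Rcomplex R).
    case: w => a b; apply/eqP; rewrite eq_complex /=.
    by rewrite !mulr0 !mulr1 addr0 add0r !eqxx.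
  by rewrite raddfD; congr (_ + _); exact: gZ.
have uE w : complex.Re ((- g1 +i* gi)%C * w) = - g (w : Rcomplex R).
  by rewrite gE; case: w => a b /=; ring.
exists (- g1 +i* gi)%C, d; split=> // c Cc.
by rewrite !uE; have := gd c Cc; lra.
Qed.

End Separation.

(** * Dissipative estimates and the operator norm *)

Section OperatorNorm.
Variables (R : realType) (A : normedAlgType R).
Implicit Types (a b x y : A) (t w : R).
Local Open Scope nualg_scope.

Lemma anorm_normalize y : y != 0 ->
  exists2 x : A, anorm x = 1 & y = (anorm y)%:C%C *: x.
Proof.
move=> y0; have n0 : anorm y != 0 by apply: contra y0 => /eqP/anorm0_eq0 ->.
exists ((anorm y)^-1%:C%C *: y).
  by rewrite anormZ normc_real ger0_norm ?invr_ge0 ?anorm_ge0// mulVf.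
by rewrite scalerA -rmorphM divff// scale1r.
Qed.

(** For a unit vector [x] and any [z] in the nonempty range of [b] at [x], the norm of [x - t b x]
    is at least [|1 - t z|], hence at least [1 - t Re z]. *)
Lemma dissipative_le b w t y :
  (forall z, num_range A b z -> complex.Re z <= w) -> 0 <= t ->
  (1 - t * w) * anorm y <= anorm (y - t%:C%C *: (b ** y)).
Proof.
move=> bw t0; have [->|/anorm_normalize[x x1 ->]] := eqVneq y 0.
  by rewrite anorm0 mulr0 anorm_ge0.
set n := anorm y; have n0 : 0 <= n by exact: anorm_ge0.
have -> : n%:C%C *: x - t%:C%C *: (b ** (n%:C%C *: x)) =
    n%:C%C *: (1 *: x + (- t%:C%C) *: (b ** x)).
  by rewrite numulZr scaleNr scale1r scalerBr !scalerA [n%:C%C * _]mulrC.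
rewrite !anormZ x1 mulr1 normc_real ger0_norm// mulrC ler_wpM2l//.
have [z xz] := num_range_at_nonempty b x1.
apply: le_trans (num_range_at_le _ _ xz).
apply: le_trans (Re_le_normc _).
have zw : complex.Re z <= w by apply: bw; exists x.
rewrite ReD mulNr ReN ReZ /= lerD2l lerN2.
exact: ler_wpM2l.
Qed.

(* Apply the dissipative estimate to (1 + t b) x, for which
   (1 - t b) (1 + t b) x = x - t^2 b^2 x. *)
Lemma op_norm_1D_le b w t :
  (forall z, num_range A b z -> complex.Re z <= w) -> 0 <= t ->
  0 <= 1 - t * w ->
  (1 - t * w) * op_norm (ue_one A + t%:C%C *: ue_inj b)
    <= 1 + t ^+ 2 * anorm b ^+ 2.
Proof.
move=> bw t0; rewrite le_eqVlt => /predU1P[<-|tw].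
  by rewrite mul0r addr_ge0// mulr_ge0 ?sqr_ge0.
rewrite -ler_pdivlMl//; apply: op_norm_le => x x1.
rewrite ler_pdivlMl//; set y := ue_act _ x.
have yE : y = x + t%:C%C *: (b ** x).
  by rewrite /y /ue_act /= add0r numulZl scaler0 addr0 scale1r addrC.
apply: le_trans (dissipative_le y bw t0) _.
have -> : y - t%:C%C *: (b ** y) = x - (t ^+ 2)%:C%C *: (b ** (b ** x)).
  rewrite yE numulDr numulZr scalerDr opprD addrA addrK scalerA -rmorphM.
  by rewrite expr2.
apply: le_trans (anormD _ _) _; rewrite lerD// anormN anormZ normc_real.
rewrite ger0_norm ?sqr_ge0// ler_wpM2l ?sqr_ge0//.
apply: le_trans (anormM _ _) _; rewrite expr2 ler_wpM2l ?anorm_ge0//.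
apply: le_trans (anormM _ _) _.
by rewrite ler_piMr ?anorm_ge0.
Qed.

End OperatorNorm.

(** * Comparison of the numerical ranges *)

Section SpatialRange.
Variables (R : realType) (A : normedAlgType R).
Implicit Types (a x : A).
Local Open Scope nualg_scope.

(** The vector [x] excludes the zero algebra, over which the operator norm of [ue_one A] is 0. *)
Lemma op_norm_one x : x != 0 -> op_norm (ue_one A) = 1.
Proof.
move=> /anorm_normalize[y y1 _]; apply/eqP; rewrite eq_le; apply/andP; split.
  by rewrite (le_trans (op_norm_le_l1 _))// /l1_norm anorm0 add0r Normc.normc1.
have := @op_norm_ub _ _ (ue_one A) y; rewrite y1 => /(_ (lexx _)).
by rewrite /ue_act /= numul0r add0r scale1r y1.
Qed.

(** A support functional at [ue_one A] forces its operator norm to be at least 1, which fails over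
    the zero algebra. *)
Lemma num_range_at_op_nontrivial u z :
  num_range_at (ue_op A) u (ue_one A) z -> exists x : A, anorm x = 1.
Proof.
move=> uz; suff [y /anorm_normalize[x x1 _]] : exists y : A, y != 0.
  by exists x.
apply: contrapT => A0.
have : normc 1 <= op_norm (ue_one A).
  by have := num_range_at_le 1 0 uz; rewrite mul0r addr0 scale0r addr0 scale1r.
rewrite Normc.normc1 leNgt => /negP; apply; rewrite (le_lt_trans _ ltr01)//.
apply: op_norm_le => x _.
have [->|x0] := eqVneq x 0; last by case: A0; exists x.
by rewrite /ue_act scaler0 numulr0 addr0 anorm0.
Qed.

(** The vector [s x + t a x] is the image of the unit vector [x] under [s 1 + t a], so its norm is
    at most the operator norm of [s 1 + t a]. *)
Lemma num_range_sub_op a :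
  num_range A a `<=` num_range_at (ue_op A) (ue_inj a) (ue_one A).
Proof.
move=> z [x /= x1 xz].
have x0 := anorm1_neq0 x1.
rewrite num_range_atE; last exact: op_norm_one x0.
move=> s t; apply: le_trans (num_range_at_le s t xz) _.
have := ue_act_op (s *: ue_one A + t *: (ue_inj a ** ue_one A)) x.
rewrite x1 mulr1; apply: le_trans.
have -> : ue_act (s *: ue_one A + t *: (ue_inj a ** ue_one A)) x =
    s *: x + t *: (a ** x).
  rewrite ue_mulr1 /ue_act /= scaler0 add0r numulZl addrC.
  by rewrite [s *: 1]mulr1 scaler0 addr0.
exact: lexx.
Qed.

(** Here [x] has operator norm 1, and submultiplicativity of that norm on the unitization gives the
    comparison. *)
Lemma num_range_op_sub_op a :
  num_range (alg_op A) a `<=` num_range_at (ue_op A) (ue_inj a) (ue_one A).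
Proof.
move=> z [x /= x1 xz].
have x0 : (x : A) != 0 := anorm1_neq0 x1.
rewrite num_range_atE; last exact: op_norm_one x0.
move=> s t; apply: le_trans (num_range_at_le s t xz) _.
have := op_normM (s *: ue_one A + t *: (ue_inj a ** ue_one A)) (ue_inj (x : A)).
rewrite [X in _ * X]x1 mulr1; apply: le_trans.
rewrite ue_mulr1 numulDl !numulZl ue_mul1 -ue_injM.
have -> : s *: ue_inj (x : A) + t *: ue_inj (a ** x) =
    ue_inj (s *: (x : A) + t *: (a ** x)).
  by congr (_, _); rewrite /= !scaler0 addr0.
exact: lexx.
Qed.

Lemma l1_norm_one : anorm (ue_one A : ue_l1 A) = 1.
Proof. by rewrite /anorm /= /l1_norm anorm0 add0r Normc.normc1. Qed.

(** A larger norm weakens the inequalities that describe the range at [ue_one A]. *)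
Lemma num_range_at_op_sub_l1 u :
  num_range_at (ue_op A) u (ue_one A) `<=` num_range_at (ue_l1 A) u (ue_one A).
Proof.
move=> z uz; rewrite num_range_atE ?l1_norm_one// => s t.
apply: le_trans (num_range_at_le s t uz) _; exact: op_norm_le_l1.
Qed.

Lemma closed_convex_hull_sub (K C : set R[i]) :
  closed (C : set R[i]^o) ->
  convex_set (C : set (convex_lmodType (Rcomplex R))) ->
  K `<=` C -> closed_convex_hull K `<=` C.
Proof. by move=> clC cvC KC z; apply. Qed.

Lemma num_range_at_op_sub_hull a :
  num_range_at (ue_op A) (ue_inj a) (ue_one A)
    `<=` closed_convex_hull (num_range A a).
Proof.
move=> z az C [clC cvC aC]; apply: contrapT => nCz.
have [x x1] := num_range_at_op_nontrivial az.
have C0 : C !=set0.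
  have [c xc] := num_range_at_nonempty a x1.
  by exists c; apply: aC; exists x.
have [u [d [d0 ud]]] := strict_separation C0 clC nCz cvC.
pose b := u *: a; pose w := complex.Re (u * z) - d.
have bw c : num_range A b c -> complex.Re c <= w.
  move=> [y y1 [f yf <-]]; rewrite /b numulZl linearZ; apply: ud.
  by apply: aC; exists y => //; exists f.
pose N := anorm b ^+ 2.
have key t : 0 <= t -> 0 <= 1 - t * w ->
    (1 - t * w) * (1 + t * (w + d)) <= 1 + t ^+ 2 * N.
  move=> t0 tw; apply: le_trans (op_norm_1D_le bw t0 tw).
  rewrite ler_wpM2l//.
  (* The operator norm of [1 + t b] is at least [Re (1 + t u z) = 1 + t (w + d)]. *)
  have := num_range_at_le 1 (t%:C%C * u) az.
  rewrite ue_mulr1 scale1r -scalerA => le1.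
  have ub : u *: ue_inj a = ue_inj b by rewrite /ue_inj -[in RHS](scaler0 _ u).
  rewrite ub in le1; apply: le_trans le1; apply: le_trans (Re_le_normc _).
  by rewrite ReD -mulrA ReZ /w subrK.
have K0 : 0 <= N + `|w * (w + d)| by rewrite addr_ge0 ?sqr_ge0.
have dw0 : 0 <= d * `|w| by rewrite mulr_ge0// ltW.
(* Expanded, [key] says [t d <= t^2 (N + w (w + d))]. With [t = d / D] the first summand of [D]
   ensures [t w <= 1], and the others make [t (N + w (w + d)) < d], a contradiction. *)
pose D := d * `|w| + (N + `|w * (w + d)|) + 1.
have D0 : 0 < D by rewrite ltr_wpDl// addr_ge0.
pose t := d / D; have t0 : 0 < t by rewrite divr_gt0.
have tD : t * D = d by rewrite mulfVK// gt_eqF.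
have tw : 0 <= 1 - t * w.
  rewrite subr_ge0 (le_trans (ler_norm _))// normrM gtr0_norm//.
  by rewrite /t mulrAC ler_pdivrMr// mul1r /D -addrA lerDl addr_ge0.
have := key t (ltW t0) tw.
have tK : t * (N + w * (w + d)) < d.
  rewrite -[ltRHS]tD ltr_pM2l// /D.
  by have := ler_norm (w * (w + d)); lra.
have := mulr_gt0 t0 (etrans (subr_gt0 _ _) tK).
lra.
Qed.


(* An empty range has an empty hull; otherwise A is nonzero, so that the norm of
   ue_one A is 1. *)
Lemma hull_sub_num_range_at_op a :
  closed_convex_hull (num_range A a)
    `<=` num_range_at (ue_op A) (ue_inj a) (ue_one A).
Proof.
have [[c [x /= x1 _]]|a0] := pselect (num_range A a !=set0).
  have x0 := anorm1_neq0 x1.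
  have one1 : anorm (ue_one A : ue_op A) = 1 := op_norm_one x0.
  apply: closed_convex_hull_sub; last exact: num_range_sub_op.
    exact: num_range_at_closed one1.
  exact: num_range_at_convex one1.
move=> z /(_ set0) []; split; first exact: closed0.
  by move=> ? ? ?; rewrite inE.
by move=> c ac; apply: a0; exists c.
Qed.

(** For [z = 0] the criterion compares [|s|] with [|s|] plus the norm of [t a]; the functional
    behind it is the scalar coordinate. *)
Lemma num_range_at_l1_0 a : num_range_at (ue_l1 A) (ue_inj a) (ue_one A) 0.
Proof.
rewrite num_range_atE ?l1_norm_one// => s t.
rewrite ue_mulr1 mulr0 addr0 /anorm /= /l1_norm /=.
by rewrite [s *: 1]mulr1 !scaler0 add0r addr0 lerDr anorm_ge0.
Qed.

End SpatialRange.

Theorem theorem2p6 (R : realType) (A : normedAlgType R) (hA : faithful A)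
    (a : A) (lambda : R[i]) :
  closed_convex_hull (num_range A a)
    = num_range_at (ue_op A) (ue_inj a) (ue_one A) /\
  num_range (alg_op A) a `<=` closed_convex_hull (num_range A a) /\
  closed_convex_hull (num_range A a `|` [set 0])
    `<=` num_range_at (ue_l1 A) (ue_inj a) (ue_one A) /\
  num_range (alg_op A) a `<=` num_range_at (ue_op A) (ue_inj a) (ue_one A) /\
  num_range (alg_op A) a `<=` num_range_at (ue_l1 A) (ue_inj a) (ue_one A) /\
  num_range_at (ue_op A) (ue_inj a + lambda *: ue_one A) (ue_one A)
    `<=` num_range_at (ue_l1 A) (ue_inj a + lambda *: ue_one A) (ue_one A).
Proof.
split; first by apply/seteqP; split;
  [exact: hull_sub_num_range_at_op|exact: num_range_at_op_sub_hull].
split.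
  by move=> z /num_range_op_sub_op; exact: num_range_at_op_sub_hull.
split.
  apply: closed_convex_hull_sub.
  - exact: num_range_at_closed (l1_norm_one A).
  - exact: num_range_at_convex (l1_norm_one A).
  - move=> z [/num_range_sub_op|->]; first exact: num_range_at_op_sub_l1.
    exact: num_range_at_l1_0.
split; first exact: num_range_op_sub_op.
split; last exact: num_range_at_op_sub_l1.
by move=> z /num_range_op_sub_op; exact: num_range_at_op_sub_l1.
Qed.
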